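(* Let $\mu>0$ and let $\theta:\mathcal X^n\to\mathbb R^p$ be a multivariate statistic with $\Delta_2(\theta;\mathcal X^n)=\Delta_2>0$ (finite). Let $M_G$ be the ordinary Gaussian mechanism, $M_{JS0}$ the James–Stein Gaussian mechanism shrinking to zero, and $M_{JS}$ the James–Stein Gaussian mechanism shrinking to average, all calibrated to satisfy $\mu$-GDP, i.e. with $\sigma=\Delta_2/\mu$. (i) If $p\ge3$, then $M_{JS0}$ strictly dominates $M_G$. (ii) If $p\ge4$, then $M_{JS}$ strictly dominates $M_G$.
   Context: $\mathcal X$ is a sample space; $S,S'\in\mathcal X^n$ are neighbors ($S\sim S'$) if they differ in exactly one record. $\Delta_2(\theta;\mathcal X^n)=\sup_{S\sim S'}\|\theta(S)-\theta(S')\|_2$. For $\sigma>0$ the mechanisms are: $M_G(S)=\theta(S)+N_p(0,\sigma^2I_p)$ (meaning $\theta(S)$ plus a $N_p(0,\sigma^2 I_p)$ random vector); $M_{JS0}(S)=m_0(M_G(S);\sigma)$ where $m_0(x;\sigma)=\Big(1-\frac{(p-2)\sigma^2}{\|x\|_2^2}\Big)x$; $M_{JS}(S)=m_a(M_G(S);\sigma)$ where $m_a(x;\sigma)=\bar x\mathbf 1_p+\Big(1-\frac{(p-3)\sigma^2}{\|x_c\|_2^2}\Big)x_c$, with $\mathbf 1_p=(1,\dots,1)^\top\in\mathbb R^p$, $\bar x=p^{-1}\mathbf 1_p^\top x$, $x_c=x-\bar x\mathbf 1_p$ (values on the null sets where a denominator vanishes are immaterial). For a mechanism $M$ perturbing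 $\theta$ and a fixed data set $S$, the $L_2$-cost is $L_2(M(S))=\mathbb E\|M(S)-\theta(S)\|_2^2$, the expectation being over the randomness of $M$ with $S$ fixed. $M$ strictly dominates $M'$ if $L_2(M(S))<L_2(M'(S))$ for every $S\in\mathcal X^n$. *)

(* Defs.v *)
From HB Require Import structures.
From mathcomp Require Import all_boot all_order all_algebra.
From mathcomp Require Import all_classical all_reals all_analysis.

Set Implicit Arguments.
Unset Strict Implicit.
Unset Printing Implicit Defensive.

Import Order.TTheory GRing.Theory Num.Theory.

Local Open Scope classical_set_scope.
Local Open Scope ring_scope.

(* The norm `|x| that the library puts on 'rV[R]_p is the sup norm. *)
Definition l2norm {R : realType} {p : nat} (x : 'rV[R]_p) : R :=
  Num.sqrt (\sum_i x 0 i ^+ 2).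

Definition neighbors {X : Type} {n : nat} (S S' : n.-tuple X) : Prop :=
  exists! i : 'I_n, tnth S i <> tnth S' i.

(* The supremum is taken in \bar R: finiteness is not built in. *)
Definition l2_sensitivity {R : realType} {X : Type} {n p : nat}
    (theta : n.-tuple X -> 'rV[R]_p) : \bar R :=
  ereal_sup [set r | exists S S', neighbors S S' /\
                     r = (l2norm (theta S - theta S'))%:E].

Definition mutually_independent {R : realType} {d : measure_display}
    {Omega : measurableType d} (P : probability Omega R) {p : nat}
    (Z : 'I_p -> {RV P >-> R}) : Prop :=
  forall (J : {set 'I_p}) (B : 'I_p -> set R),
    (forall i, measurable (B i)) ->
    P [set w | forall i, i \in J -> B i (Z i w)] =
    (\prod_(i in J) P (Z i @^-1` B i))%E.

Definition noise_vector {R : realType} {d : measure_display}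
    {Omega : measurableType d} (P : probability Omega R) {p : nat}
    (Z : 'I_p -> {RV P >-> R}) (w : Omega) : 'rV[R]_p := \row_i Z i w.

(* noise_vector Z ~ N_p(0, sigma^2 I_p), given by its coordinates.  The second
   parameter of normal_prob is the standard deviation, not the variance. *)
Definition isotropic_gaussian {R : realType} {d : measure_display}
    {Omega : measurableType d} (P : probability Omega R) {p : nat} (sigma : R)
    (Z : 'I_p -> {RV P >-> R}) : Prop :=
  mutually_independent Z /\
  forall (i : 'I_p) (B : set R), measurable B ->
    distribution P (Z i) B = normal_prob 0 sigma B.

Definition coord_mean {R : realType} {p : nat} (x : 'rV[R]_p) : R :=
  p%:R^-1 * \sum_i x 0 i.

Definition centered {R : realType} {p : nat} (x : 'rV[R]_p) : 'rV[R]_p :=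
  x - const_mx (coord_mean x).

(* In both shrinkage maps a vanishing denominator has inverse 0, so that
   js_zero sigma 0 = 0 and js_avg sigma x = x when x is constant.  The
   subtractions p%:R - 2 and p%:R - 3 are in R, not truncated. *)
Definition js_zero {R : realType} {p : nat} (sigma : R) (x : 'rV[R]_p) :
    'rV[R]_p :=
  (1 - (p%:R - 2) * sigma ^+ 2 / l2norm x ^+ 2) *: x.

Definition js_avg {R : realType} {p : nat} (sigma : R) (x : 'rV[R]_p) :
    'rV[R]_p :=
  const_mx (coord_mean x) +
  (1 - (p%:R - 3) * sigma ^+ 2 / l2norm (centered x) ^+ 2) *: centered x.

(* A mechanism is a random vector for every data set: S |-> (w |-> M S w). *)
Definition gaussian_mech {R : realType} {X : Type} {d : measure_display}
    {Omega : measurableType d} (P : probability Omega R) {n p : nat}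
    (theta : n.-tuple X -> 'rV[R]_p) (Z : 'I_p -> {RV P >-> R})
    (S : n.-tuple X) (w : Omega) : 'rV[R]_p :=
  theta S + noise_vector Z w.

Definition js_zero_mech {R : realType} {X : Type} {d : measure_display}
    {Omega : measurableType d} (P : probability Omega R) {n p : nat}
    (sigma : R) (theta : n.-tuple X -> 'rV[R]_p) (Z : 'I_p -> {RV P >-> R})
    (S : n.-tuple X) (w : Omega) : 'rV[R]_p :=
  js_zero sigma (gaussian_mech theta Z S w).

Definition js_avg_mech {R : realType} {X : Type} {d : measure_display}
    {Omega : measurableType d} (P : probability Omega R) {n p : nat}
    (sigma : R) (theta : n.-tuple X -> 'rV[R]_p) (Z : 'I_p -> {RV P >-> R})
    (S : n.-tuple X) (w : Omega) : 'rV[R]_p :=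
  js_avg sigma (gaussian_mech theta Z S w).

Definition l2_cost {R : realType} {X : Type} {d : measure_display}
    {Omega : measurableType d} (P : probability Omega R) {n p : nat}
    (theta : n.-tuple X -> 'rV[R]_p) (M : n.-tuple X -> Omega -> 'rV[R]_p)
    (S : n.-tuple X) : \bar R :=
  'E_P[fun w => l2norm (M S w - theta S) ^+ 2].

Definition strictly_dominates {R : realType} {X : Type} {d : measure_display}
    {Omega : measurableType d} (P : probability Omega R) {n p : nat}
    (theta : n.-tuple X -> 'rV[R]_p)
    (M M' : n.-tuple X -> Omega -> 'rV[R]_p) : Prop :=
  forall S : n.-tuple X, (l2_cost P theta M S < l2_cost P theta M' S)%E.

(* Main.v *)
(* James-Stein without integrability at the origin.  Let Q be an orthogonal
   projection of rank r > 2 (Q = 1 shrinks to zero, the centering matrix shrinks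
   to the average), c = r - 2 and q(x) = |xQ|^2.  For 0 < e <= 1 the field
   xQ / (e + q(x)) is smooth and bounded, so Gaussian integration by parts in
   each coordinate, conditionally on the others, gives
     E|Z - c s^2 XQ / (e + q(X))|^2 <= E|Z|^2 - c^2 s^4 E[1 / (1 + q(X))]
   with a right-hand side that does not depend on e and is smaller than E|Z|^2.
   Fatou's lemma along e = 1 / (k + 1) transfers the bound to e = 0. *)
Require Import Defs.
From HB Require Import structures.
From mathcomp Require Import all_boot all_order all_algebra.
From mathcomp Require Import all_classical all_reals all_analysis.
From mathcomp Require Import measurable_realfun ring lra.

Import Order.TTheory GRing.Theory Num.Theory.
Import numFieldNormedType.Exports.

Set Implicit Arguments.
Unset Strict Implicit.

Local Open Scope classical_set_scope.
Local Open Scope ring_scope.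

(** * One-dimensional Gaussian integration by parts *)

Section normal_density.
Context {R : realType}.
Local Notation mu := (@lebesgue_measure R).

Lemma measurable_EFin_normal_pdf (m s : R) :
  measurable_fun [set: measurableTypeR R] (fun x => (normal_pdf m s x)%:E).
Proof. by apply/measurable_EFinP; exact: measurable_normal_pdf. Qed.

(** The general change of variables is phrased with the Radon-Nikodym derivative. That derivative
    and the explicit density have the same integral over every measurable set, so they agree almost
    everywhere and one may replace the other under an integral. *)
Lemma ae_normal_pdf (m s : R) :
  ae_eq mu setT (Radon_Nikodym_SigmaFinite.f (normal_prob m s) mu)
    (fun x => (normal_pdf m s x)%:E).
Proof.
have dom := @normal_prob_dominates R m s.
apply: integral_ae_eq => //=.
- exact: Radon_Nikodym_SigmaFinite.f_integrable dom.
- exact: measurable_EFin_normal_pdf.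
- by move=> E _ mE; rewrite -(Radon_Nikodym_SigmaFinite.f_integral dom mE).
Qed.

Lemma ge0_integral_normal_prob (m s : R) (f : R -> \bar R) :
  measurable_fun setT f -> (forall x, (0 <= f x)%E) ->
  (\int[normal_prob m s]_x f x = \int[mu]_x (f x * (normal_pdf m s x)%:E))%E.
Proof.
move=> mf f0; have dom := @normal_prob_dominates R m s.
rewrite -(Radon_Nikodym_SigmaFinite.change_of_variables dom)//.
apply: ae_eq_integral => //.
- apply: emeasurable_funM => //.
  exact: measurable_int (Radon_Nikodym_SigmaFinite.f_integrable _).
- apply: emeasurable_funM => //; exact: measurable_EFin_normal_pdf.
- exact/ae_eqe_mul2l/ae_normal_pdf.
Qed.

Lemma normal_prob_integrableP (m s : R) (f : R -> R) :
  measurable_fun setT f ->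
  mu.-integrable setT (fun x => (f x * normal_pdf m s x)%:E) <->
  (normal_prob m s).-integrable setT (EFin \o f).
Proof.
move=> mf.
have E : (\int[normal_prob m s]_x `|(f x)%:E| =
    \int[mu]_x `|(f x * normal_pdf m s x)%:E|)%E.
  rewrite ge0_integral_normal_prob//=; last first.
    by apply/measurable_EFinP; exact: measurableT_comp.
  apply: eq_integral => x _ /=.
  by rewrite normrM (ger0_norm (normal_pdf_ge0 _ _ _)).
split=> /integrableP[_ foo]; apply/integrableP; split.
- exact/measurable_EFinP.
- by rewrite E.
- by apply/measurable_EFinP/measurable_funM => //; exact: measurable_normal_pdf.
- by rewrite -E.
Qed.

Lemma integral_normal_prob (m s : R) (f : R -> R) :
  (normal_prob m s).-integrable setT (EFin \o f) ->
  (\int[normal_prob m s]_x (f x)%:E =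
   \int[mu]_x (f x * normal_pdf m s x)%:E)%E.
Proof.
move=> intf; have mf := measurable_int _ intf.
rewrite [LHS]integralE [RHS]integralE.
rewrite !ge0_integral_normal_prob//=;
  [|exact/measurable_funeneg|exact/measurable_funepos].
congr (_ - _)%E; apply: eq_integral => x _; rewrite !(funeposE, funenegE) /=.
- by rewrite EFinM maxe_pMl ?mul0e// lee_fin normal_pdf_ge0.
- by rewrite -mulNr EFinM maxe_pMl ?mul0e// lee_fin normal_pdf_ge0.
Qed.

(** Half of the Gaussian exponent absorbs the polynomial factor, and the other half is a Gaussian of
    doubled variance. This gives both the finite second moment and the decay at infinity used in
    [stein_normal]. *)
Lemma sqr_normal_pdf_le (s : R) : 0 < s ->
  exists C, forall x, x ^+ 2 * normal_pdf 0 s x <=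
    C * normal_pdf 0 (s * Num.sqrt 2) x.
Proof.
move=> s0; set s' := s * _.
have s'0 : 0 < s' by rewrite mulr_gt0// sqrtr_gt0.
have s'2 : s' ^+ 2 = s ^+ 2 * 2 by rewrite exprMn sqr_sqrtr.
exists (s ^+ 2 * 4 * normal_peak s / normal_peak s') => x.
rewrite !normal_pdfE ?gt_eqF//= /normal_fun !subr0.
rewrite [leRHS]mulrA divfK ?gt_eqF ?normal_peak_gt0 ?gt_eqF//.
(* y exp(-2y) <= exp(-y), with the right-hand side of twice the variance. *)
set y := x ^+ 2 / (s ^+ 2 * 4).
have xy : x ^+ 2 = s ^+ 2 * 4 * y.
  by rewrite /y mulrC divfK// gt_eqF// mulr_gt0 ?exprn_gt0.
have -> : - x ^+ 2 / (s ^+ 2 *+ 2) = - y - y.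
  by rewrite /y; field; rewrite gt_eqF.
have -> : - x ^+ 2 / (s' ^+ 2 *+ 2) = - y.
  by rewrite s'2 /y; field; rewrite gt_eqF.
rewrite expRD xy.
have e1 : y * expR (- y) <= 1.
  rewrite expRN ler_pdivrMr ?expR_gt0// mul1r.
  by apply: le_trans (expR_ge1Dx y); rewrite lerDr.
rewrite (_ : s ^+ 2 * 4 * y * _ =
  s ^+ 2 * 4 * normal_peak s * expR (- y) * (y * expR (- y))); last by ring.
rewrite ler_piMr//; apply: mulr_ge0; last exact: expR_ge0.
by apply: mulr_ge0; [rewrite mulr_ge0 ?sqr_ge0|exact: normal_peak_ge0].
Qed.

Lemma normal_prob_integrable_sqr (s : R) : 0 < s ->
  (normal_prob 0 s).-integrable setT (fun x : R => (x ^+ 2)%:E).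
Proof.
move=> s0; apply/normal_prob_integrableP; first exact: measurable_funX.
have [C HC] := sqr_normal_pdf_le s0.
have := integrableZl measurableT C
  (@integrable_normal_pdf R 0 (s * Num.sqrt 2)).
apply: le_integrable => //.
- apply/measurable_EFinP/measurable_funM; first exact: measurable_funX.
  exact: measurable_normal_pdf.
- move=> x _; rewrite -EFinM !abse_EFin lee_fin.
  rewrite ger0_norm; first exact: le_trans (HC x) (ler_norm _).
  by apply: mulr_ge0; [exact: sqr_ge0|exact: normal_pdf_ge0].
Qed.

Lemma is_derive_normal_pdf (s x : R) : 0 < s ->
  is_derive x 1 (normal_pdf 0 s) (- (x / s ^+ 2) * normal_pdf 0 s x).
Proof.
move=> s0; rewrite normal_pdfE ?gt_eqF// /normal_fun.
pose k := - (s ^+ 2 *+ 2)^-1.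
pose g : R -> R := k \*: (@id R ^+ 2).
have gE y : g y = - (y - 0) ^+ 2 / (s ^+ 2 *+ 2).
  by rewrite /g /k subr0 !fctE/= scaleNr mulNr mulrC.
have -> : (fun y => normal_peak s * expR (- (y - 0) ^+ 2 / (s ^+ 2 *+ 2))) =
    normal_peak s \*: (expR \o g).
  by apply/funext => y; rewrite /= gE.
apply: is_derive_eq.
rewrite -gE /GRing.scale/=.
by rewrite expr1 /k; field; rewrite gt_eqF.
Qed.

Lemma sqr_normal_pdf_bounded (s : R) : 0 < s ->
  exists2 C, 0 <= C & forall x, x ^+ 2 * normal_pdf 0 s x <= C.
Proof.
move=> s0; have [C HC] := sqr_normal_pdf_le s0.
set s' := s * Num.sqrt 2 in HC.
have s'0 : 0 < s' by rewrite mulr_gt0// sqrtr_gt0.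
exists (`|C| * normal_peak s'); first by rewrite mulr_ge0 ?normal_peak_ge0.
move=> x; apply: le_trans (HC x) _.
apply: (@le_trans _ _ (`|C| * normal_pdf 0 s' x)).
  by rewrite ler_wpM2r ?normal_pdf_ge0// ler_norm.
by rewrite ler_wpM2l// normal_pdf_ub// gt_eqF.
Qed.

(** Stein's identity [E[x f(x)] = s^2 E[f'(x)]]. With both sides under one integral, the integrand
    times the density is an exact derivative, so the fundamental theorem of calculus on growing
    intervals suffices. *)
Lemma stein_normal (s : R) (f f' : R -> R) (K : R) : 0 < s ->
  (forall x : R, is_derive x 1 f (f' x)) -> continuous f' ->
  (forall x, `|f x| <= K) -> (forall x, `|f' x| <= K) ->
  (\int[normal_prob 0 s]_x (x * f x - s ^+ 2 * f' x)%:E = 0)%E.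
Proof.
move=> s0 df cf' fK f'K.
have K0 : 0 <= K := le_trans (normr_ge0 _) (fK 0).
have cf : continuous f.
  by move=> x; apply/differentiable_continuous/derivable1_diffP; case: (df x).
have cphi : continuous (normal_pdf 0 s).
  by apply: continuous_normal_pdf; rewrite gt_eqF.
pose h x := x * f x - s ^+ 2 * f' x.
have ch : continuous h.
  move=> x; apply: cvgB; apply: cvgM;
    [exact: cvg_id|exact: cf|exact: cvg_cst|exact: cf'].
pose u x := h x * normal_pdf 0 s x.
have cu : continuous u by move=> x; apply: cvgM; [exact: ch|exact: cphi].
have mh : measurable_fun [set: measurableTypeR R] h.
  exact: continuous_measurable_fun.
have ih : (normal_prob 0 s).-integrable setT (EFin \o h).
  (* This dominates [h]: [s^2 f'] is at most [K s^2] in absolute value, and [x f] at most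
     [K (1 + x^2)] because [|x| <= 1 + x^2]. *)
  have i1 : (normal_prob 0 s).-integrable setT
      (fun x : R => (K * (1 + s ^+ 2))%:E + K%:E * (x ^+ 2)%:E)%E.
    apply: integrableD => //; first exact: finite_measure_integrable_cst.
    by apply: integrableZl => //; exact: normal_prob_integrable_sqr.
  apply: le_integrable i1 => //; first exact/measurable_EFinP.
  move=> x _; rewrite -EFinM -EFinD !abse_EFin lee_fin.
  apply: le_trans (ler_norm _); rewrite /h.
  apply: le_trans (ler_normB _ _) _.
  rewrite normrM (normrM (s ^+ 2)) (ger0_norm (sqr_ge0 s)).
  have := ler_pM (normr_ge0 x) (normr_ge0 _) (lexx `|x|) (fK x).
  have := ler_pM (normr_ge0 (s ^+ 2)) (normr_ge0 _) (lexx _) (f'K x).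
  rewrite [X in X * _ <= X * _ -> _]ger0_norm ?sqr_ge0//.
  have x1 : `|x| <= 1 + x ^+ 2.
    by rewrite -(real_normK (num_real x)); nra.
  have := ler_wpM2r K0 x1.
  lra.
have iu : mu.-integrable setT (EFin \o u) by apply/normal_prob_integrableP.
rewrite integral_normal_prob// -/(u _).
(* The integrand is the derivative of G := - s^2 f pdf, which vanishes at
   infinity. *)
pose G (x : R) : R := - s ^+ 2 * (f x * normal_pdf 0 s x).
have dG (x : R) : is_derive x 1 G (u x).
  have dphi := is_derive_normal_pdf x s0.
  apply: (is_derive_eq (is_deriveZ (- s ^+ 2) (is_deriveM (df x) dphi))).
  by rewrite /u /h /GRing.scale/=; field; rewrite gt_eqF.
have [C C0 HC] := sqr_normal_pdf_bounded s0.
(* The shift gives [a n >= 1], so [x^2 pdf(x) <= C] at [x = a n] or [x = - a n] yields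
   [pdf(x) <= C / a n]. The inverse of [a n] is [harmonic n], which tends to 0. *)
pose a (n : nat) : R := n.+1%:R.
have intG n : (\int[mu]_(x in `[(- a n)%R, a n]) (u x)%:E =
    (G (a n))%:E - (G (- a n)%R)%:E)%E.
  have a0 : 0 < a n by rewrite /a.
  apply: continuous_FTC2.
  - by rewrite gtrN.
  - exact: continuous_subspaceT.
  - have cG : continuous G.
      move=> x; apply/differentiable_continuous/derivable1_diffP.
      by case: (dG x).
    split; first by move=> x _; case: (dG x).
    + exact/cvg_at_right_filter/cG.
    + exact/cvg_at_left_filter/cG.
  - by move=> x _; rewrite derive1E; case: (dG x).
have lim0 : (\int[mu]_(x in `[(- a n)%R, a n]) (u x)%:E)%E @[n --> \oo] --> 0%E.
  under eq_fun do rewrite intG -EFinB.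
  apply: cvg_EFin; first exact: nearW.
  have GB n x : `|x| = a n -> `|G x| <= s ^+ 2 * (K * C) * harmonic n.
    move=> xn; have a0 : 0 < a n by rewrite /a.
    rewrite /G mulNr normrN normrM (ger0_norm (sqr_ge0 s)) -mulrA.
    rewrite ler_wpM2l ?sqr_ge0// normrM (ger0_norm (normal_pdf_ge0 _ _ _)).
    rewrite -mulrA.
    apply: ler_pM => //; first exact: normal_pdf_ge0.
    rewrite -/(a n) ler_pdivlMr//; apply: le_trans (HC x).
    rewrite mulrC ler_wpM2r ?normal_pdf_ge0// -(real_normK (num_real x)) xn.
    rewrite expr2 ler_peMl ?(ltW a0)//. by rewrite /a ler1n.
  have hB : (s ^+ 2 * (K * C) * harmonic n *+ 2) @[n --> \oo] --> (0 : R).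
    rewrite [X in _ --> X](_ : _ = s ^+ 2 * (K * C) * 0 *+ 2); last first.
      by rewrite mulr0 mul0rn.
    apply: cvgMn; apply: cvgM; first exact: cvg_cst.
    exact: cvg_harmonic.
  apply: (@squeeze_cvgr _ _ _ _
    (fun n => - (s ^+ 2 * (K * C) * harmonic n *+ 2))
    (fun n => s ^+ 2 * (K * C) * harmonic n *+ 2)) => //; last first.
    by rewrite -oppr0; exact: cvgN.
  apply: nearW => n; rewrite -ler_norml; apply: le_trans (ler_normB _ _) _.
  by rewrite mulr2n lerD ?GB// ?normrN ger0_norm /a.
(* The same sequence also converges to the integral over the whole line, by dominated convergence
   with bound [|u|]. Uniqueness of limits then concludes. *)
have limu : (\int[mu]_(x in `[(- a n)%R, a n]) (u x)%:E)%E @[n --> \oo] -->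
    (\int[mu]_x (u x)%:E)%E.
  under eq_fun do rewrite integral_mkcond.
  have [] := @dominated_convergence _ _ _ mu setT measurableT
    (fun n => (EFin \o u) \_ `[(- a n)%R, a n]) (EFin \o u)
    (fun x => `|(u x)%:E|%E).
  - move=> n; apply/measurable_restrict => //.
    by rewrite setTI; apply: measurable_funTS; exact: measurable_int iu.
  - exact: measurable_int iu.
  - apply/aeW => x _; apply: cvg_near_cst.
    near=> n; rewrite patchE mem_set//= in_itv/= -ler_norml.
    near: n; exists (Num.bound `|x|) => // n /= xn.
    apply/ltW/(lt_le_trans (archi_boundP (normr_ge0 x))).
    by rewrite /a ler_nat leqW.
  - exact/integrable_abse.
  - apply/aeW => x n _; rewrite patchE; case: ifPn => _; first exact: lexx.
    by rewrite abse0.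
  - done.
exact: cvg_unique limu lim0.
Unshelve. all: by end_near.
Qed.

End normal_density.

(** * Independence of one coordinate from the others *)

Section leave_one_out.
Context {R : realType} {d : measure_display} {Omega : measurableType d}
  (P : probability Omega R) {p : nat} (Z : 'I_p -> {RV P >-> R}).

(* measurableTypeR R and R carry the same measurable sets under different
   displays; normal_prob is a measure on the former, the Z j take values in the
   latter. *)
Definition others (i : 'I_p) (w : Omega) : p.-tuple (measurableTypeR R) :=
  [tuple if j == i then 0 else Z j w | j < p].

Definition with_others (i : 'I_p) (w : Omega) :
    measurableTypeR R * p.-tuple (measurableTypeR R) := (Z i w, others i w).

Lemma measurable_others i : measurable_fun setT (others i).
Proof.
apply/measurable_fun_tnthP => j.
rewrite (_ : _ \o _ = if j == i then cst 0 else Z j).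
  by case: ifP => _; [exact: measurable_cst|exact: (measurable_funP (Z j))].
by apply/funext => w /=; rewrite tnth_mktuple; case: ifP.
Qed.

Lemma measurable_with_others i : measurable_fun setT (with_others i).
Proof.
apply/measurable_fun_pair; last exact: measurable_others.
exact: (measurable_funP (Z i)).
Qed.

HB.instance Definition _ i :=
  isMeasurableFun.Build _ _ _ _ (others i) (measurable_others i).

HB.instance Definition _ i :=
  isMeasurableFun.Build _ _ _ _ (with_others i) (measurable_with_others i).

Let box (B : 'I_p -> set (measurableTypeR R)) :
    set (p.-tuple (measurableTypeR R)) := [set t | forall j, B j (tnth t j)].

(** A pi-system on which independence is directly applicable. Two finite measures that agree on it
    agree on the sigma-algebra it generates. *)
Let cylinder : set (set (measurableTypeR R * p.-tuple (measurableTypeR R))) :=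
  [set C | exists A, measurable A /\
     exists B, (forall j, measurable (B j)) /\ C = A `*` box B].

Let measurable_box B : (forall j, measurable (B j)) -> measurable (box B).
Proof.
move=> mB; rewrite (_ : box B =
    \bigcap_j ((@tnth p (measurableTypeR R))^~ j @^-1` B j)).
  apply: fin_bigcap_measurable => // j _.
  rewrite -[X in measurable X]setTI; exact: measurable_tnth.
by apply/seteqP; split => t; [move=> h j _; exact: h|move=> h j; exact: h].
Qed.

(** It is enough that both projections are measurable for the generated sigma-algebra. For the tuple
    component this is checked one coordinate at a time, by boxes constrained in a single slot. *)
Let cylinder_generates X : measurable X -> <<s cylinder >> X.
Proof.
rewrite measurable_prod_measurableType; apply: smallest_sub.
  exact: smallest_sigma_algebra.
pose T : measurableType _ := g_sigma_algebraType cylinder.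
move=> _ [A mA [B mB <-]].
have m1 : measurable_fun [set: T] fst.
  move=> _ C mC; rewrite setTI; apply: sub_sigma_algebra.
  exists C; split => //; exists (fun=> setT); split => //.
  by apply/seteqP; split => -[x t] //= [].
have m2 : measurable_fun [set: T] snd.
  apply/measurable_fun_tnthP => j _ C mC; rewrite setTI.
  apply: sub_sigma_algebra.
  exists setT; split => //; exists (fun k => if k == j then C else setT); split.
    by move=> k; case: ifP.
  apply/seteqP; split => -[x t] /=.
    by move=> Ct; split => // k; case: eqP => [->|].
  by move=> [_ /(_ j)]; rewrite eqxx.
have -> : A `*` B = (fst @^-1` A) `&` (snd @^-1` B) by [].
apply: (@measurableI _ T).
- by rewrite -[X in measurable X]setTI; exact: m1.
- by rewrite -[X in measurable X]setTI; exact: m2.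
Qed.

Hypothesis indepZ : mutually_independent Z.

Let indep_box i A B : measurable A -> (forall j, measurable (B j)) ->
  P (with_others i @^-1` (A `*` box B)) =
  (P (Z i @^-1` A) * P (others i @^-1` box B))%E.
Proof.
move=> mA mB.
have [Bi0|nBi0] := pselect (B i 0); last first.
  have e0 : others i @^-1` box B = set0.
    apply/seteqP; split => // w /= /(_ i); rewrite tnth_mktuple eqxx.
    by move/nBi0.
  rewrite e0 measure0 mule0 (_ : _ @^-1` _ = set0) ?measure0//.
  apply/seteqP; split => // w [_ /= Bw].
  by have : (others i @^-1` box B) w by []; rewrite e0.
(* Putting [A] in the free slot turns the joint event into a single box event on all of [Z].
   Independence is then used twice, over all indices and over all indices but [i]. *)
pose B' j := if j == i then A else B j.
have mB' j : measurable (B' j) by rewrite /B'; case: ifP.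
have -> : with_others i @^-1` (A `*` box B) =
    [set w | forall j, j \in [set: 'I_p]%SET -> B' j (Z j w)].
  apply/seteqP; split => w /=.
    move=> [/= Aw Bw] j _; rewrite /B'; case: eqP => [->//|/eqP ji].
    by have := Bw j; rewrite tnth_mktuple (negbTE ji).
  move=> h; split => /=.
    by have := h i (finset.in_setT _); rewrite /B' eqxx.
  move=> j; rewrite tnth_mktuple; case: eqP => [->//|/eqP ji].
  by have := h j (finset.in_setT _); rewrite /B' (negbTE ji).
have -> : others i @^-1` box B =
    [set w | forall j, j \in [set~ i]%SET -> B j (Z j w)].
  apply/seteqP; split => w /=.
    move=> Bw j; rewrite !inE => ji.
    by have := Bw j; rewrite tnth_mktuple (negbTE ji).
  move=> h j; rewrite tnth_mktuple; case: eqP => [->//|/eqP ji].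
  by apply: h; rewrite !inE.
rewrite !indepZ// (bigD1 i) ?inE//=; congr (_ * _)%E; first by rewrite /B' eqxx.
apply: eq_big => [j|j]; first by rewrite !inE.
by rewrite !inE /B' => /andP[_ /negbTE ->].
Qed.

Lemma with_others_prod (s : R) i
    (X : set (measurableTypeR R * p.-tuple (measurableTypeR R))) :
  (forall B : set (measurableTypeR R), measurable B ->
     distribution P (Z i) B = normal_prob 0 s B) ->
  measurable X ->
  distribution P (with_others i) X =
  (normal_prob 0 s \x distribution P (others i))%E X.
Proof.
move=> hZ mX.
apply: (g_sigma_algebra_measure_unique cylinder _ (fun=> setT)).
- move=> _ [A [mA [B [mB ->]]]].
  by apply: measurableX => //; exact: measurable_box.
- move=> _; exists setT; split => //; exists (fun=> setT); split => //.
  by apply/seteqP; split => -[x t].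
- by rewrite bigcup_const.
- move=> _ _ [A [mA [B [mB ->]]]] [A' [mA' [B' [mB' ->]]]].
  exists (A `&` A'); split; first exact: measurableI.
  exists (fun j => B j `&` B' j); split; first by move=> j; exact: measurableI.
  apply/seteqP; split => -[x t] /=.
    by move=> [[Ax Bt] [A'x B't]]; split => // j; split.
  by move=> [[Ax A'x] BB']; split; split => // j; case: (BB' j).
- move=> _ [A [mA [B [mB ->]]]].
  apply/esym; etransitivity.
    exact: (product_measure1E _ _ mA (measurable_box mB)).
  apply/esym; transitivity (P (Z i @^-1` A) * P (others i @^-1` box B))%E.
    exact: indep_box.
  by congr (_ * _)%E; exact: hZ mA.
- move=> k.
  by rewrite [ltLHS](@probability_setT _ _ _ (distribution P (with_others i))) ltry.
- exact: cylinder_generates.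
Qed.

(** Conditioning on the other coordinates, in the form of Fubini: the joint law is a product, so the
    integral may be taken over the [i]-th coordinate first, where it vanishes for each frozen value
    of the others. *)
Lemma integral_with_others0 (s : R) i
    (g : measurableTypeR R * p.-tuple (measurableTypeR R) -> R) :
  (forall B : set (measurableTypeR R), measurable B ->
     distribution P (Z i) B = normal_prob 0 s B) ->
  measurable_fun setT g ->
  P.-integrable setT (EFin \o (g \o with_others i)) ->
  (forall y, \int[normal_prob 0 s]_x (g (x, y))%:E = 0)%E ->
  (\int[P]_w (g (with_others i w))%:E = 0)%E.
Proof.
move=> hZ mg ig g0.
have mEg : measurable_fun setT (EFin \o g) by exact/measurable_EFinP.
transitivity (\int[distribution P (with_others i)]_z (g z)%:E)%E.
  by rewrite integral_distribution.
have eqm (f : _ -> \bar R) : (\int[distribution P (with_others i)]_z f z =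
    \int[normal_prob 0 s \x distribution P (others i)]_z f z)%E.
  by apply: eq_measure_integral => A mA _; exact: with_others_prod.
rewrite eqm -integral21_prod_meas1.
  by apply: integral0_eq => y _; exact: g0.
apply/integrableP; split => //; rewrite -eqm.
rewrite ge0_integral_distribution//; last exact: measurableT_comp.
by have /integrableP[] := ig.
Qed.

End leave_one_out.

(** * The regularized shrinkage field *)

Section shrinkage.
Context {R : realType} {p : nat} (Q : 'M[R]_p).
Implicit Types (x u : 'rV[R]_p) (e : R) (i j : 'I_p).

Definition sqnorm x : R := \sum_j (x *m Q) 0 j ^+ 2.

Definition shrink e x i : R := (x *m Q) 0 i / (e + sqnorm x).

(* The derivative of t |-> shrink e (x + t *: delta_mx 0 i) i at 0, when Q is a
   symmetric idempotent. *)
Definition shrink_deriv e x i : R :=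
  Q i i / (e + sqnorm x) - 2 * (x *m Q) 0 i ^+ 2 / (e + sqnorm x) ^+ 2.

Lemma sqnorm_ge0 x : 0 <= sqnorm x.
Proof. by apply: sumr_ge0 => j _; exact: sqr_ge0. Qed.

Lemma sqr_le_sqnorm x i : (x *m Q) 0 i ^+ 2 <= sqnorm x.
Proof.
rewrite /sqnorm (bigD1 i)//= lerDl.
by apply: sumr_ge0 => j _; exact: sqr_ge0.
Qed.

Lemma add_sqnorm_gt0 e x : 0 < e -> 0 < e + sqnorm x.
Proof. by move=> e0; rewrite ltr_pwDl// sqnorm_ge0. Qed.

Lemma inv_add_sqnorm_le e x : 0 < e -> (e + sqnorm x)^-1 <= e^-1.
Proof.
move=> e0; rewrite lef_pV2 ?posrE ?add_sqnorm_gt0//.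
by rewrite lerDl sqnorm_ge0.
Qed.

(** With [y] the [i]-th coordinate of [xQ], the claim reduces to [e |y| <= e + y^2]. This is clear
    for [|y| <= 1], and for [|y| > 1] it follows from [e <= 1]. *)
Lemma norm_shrink_le e x i : 0 < e <= 1 -> `|shrink e x i| <= e^-1.
Proof.
move=> /andP[e0 e1]; have De := add_sqnorm_gt0 x e0.
rewrite normrM normfV (gtr0_norm De) ler_pdivrMr// mulrC ler_pdivlMr//.
have := sqr_le_sqnorm x i; rewrite -(real_normK (num_real ((x *m Q) 0 i))).
have := normr_ge0 ((x *m Q) 0 i); nra.
Qed.

(** In the second term, the squared coordinate is at most [e + sqnorm x] and cancels one factor of
    the denominator, leaving [2 / (e + sqnorm x)]. *)
Lemma norm_shrink_deriv_le e x i : 0 < e ->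
  `|shrink_deriv e x i| <= (`|Q i i| + 2) / e.
Proof.
move=> e0; have De := add_sqnorm_gt0 x e0; have Dle := inv_add_sqnorm_le x e0.
have Dinv : 0 < (e + sqnorm x)^-1 by rewrite invr_gt0.
apply: le_trans (ler_normB _ _) _; rewrite [leRHS]mulrDl; apply: lerD.
  by rewrite normrM (gtr0_norm Dinv) ler_wpM2l.
rewrite ger0_norm; last first.
  by apply: divr_ge0; [apply: mulr_ge0 => //; exact: sqr_ge0|exact: sqr_ge0].
rewrite -mulrA ler_wpM2l//; apply: le_trans Dle.
rewrite expr2 invfM mulrA ler_piMl ?(ltW Dinv)// ler_pdivrMr// mul1r.
by apply: le_trans (sqr_le_sqnorm x i) _; rewrite lerDr ltW.
Qed.

Hypotheses (Qsym : Q^T = Q) (Qidem : Q *m Q = Q).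

(** The sum is what the chain rule produces when [sqnorm] is differentiated along coordinate [i]. It
    collapses because [xQ] is fixed by the symmetric projection [Q]. *)
Lemma sum_proj_row x i : \sum_j (x *m Q) 0 j * Q i j = (x *m Q) 0 i.
Proof.
have {2}-> : x *m Q = (x *m Q) *m Q^T by rewrite Qsym -mulmxA Qidem.
by rewrite [RHS]mxE; apply: eq_bigr => j _; congr (_ * _); rewrite mxE.
Qed.

Lemma proj_line u t i j :
  ((u + t *: delta_mx 0 i) *m Q) 0 j = (u *m Q) 0 j + t * Q i j.
Proof. by rewrite mulmxDl -scalemxAl -rowE !mxE. Qed.

Lemma is_derive_proj u i j t :
  is_derive t (1 : R) (fun t : R => ((u + t *: delta_mx 0 i) *m Q) 0 j) (Q i j).
Proof.
rewrite (_ : (fun _ => _) = cst ((u *m Q) 0 j) + Q i j \*: @id R); last first.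
  by apply/funext => y; rewrite proj_line mulrC.
by apply: is_derive_eq; rewrite add0r /GRing.scale/= mulr1.
Qed.

Lemma is_derive_sqnorm u i (t : R) :
  is_derive t (1 : R) (fun t : R => sqnorm (u + t *: delta_mx 0 i))
    (2 * ((u + t *: delta_mx 0 i) *m Q) 0 i).
Proof.
pose f j (t : R) := ((u + t *: delta_mx 0 i) *m Q) 0 j.
rewrite (_ : (fun _ => _) = \sum_j (f j ^+ 2)); last first.
  by apply/funext => y; rewrite fct_sumE.
have df j : is_derive t (1 : R) (f j ^+ 2) (2 * (f j t * Q i j)).
  apply: (is_derive_eq (is_deriveX 2 (is_derive_proj u i j t))).
  by rewrite /GRing.scale/= expr1 mulrA.
apply: (is_derive_eq (is_derive_sum df)).
by rewrite -mulr_sumr sum_proj_row.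
Qed.

Lemma is_derive_shrink e u i (t : R) : 0 < e ->
  is_derive t (1 : R) (fun t : R => shrink e (u + t *: delta_mx 0 i) i)
    (shrink_deriv e (u + t *: delta_mx 0 i) i).
Proof.
move=> e0.
pose f (t : R) := ((u + t *: delta_mx 0 i) *m Q) 0 i.
pose D : R -> R := cst e + (fun t : R => sqnorm (u + t *: delta_mx 0 i)).
have D0 y : D y != 0 by rewrite gt_eqF// add_sqnorm_gt0.
have dD := is_deriveD (is_derive_cst e t (1 : R)) (is_derive_sqnorm u i t).
have dV := @is_deriveV R D t _ _ (D0 t) dD.
apply: (is_derive_eq (is_deriveM (is_derive_proj u i i t) dV)).
rewrite /shrink_deriv /GRing.scale/= -/(f t) add0r.
have := D0 t; rewrite /D /= !fctE/=; move: (e + _) => d d0.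
by field.
Qed.

Lemma continuous_shrink_deriv e u i : 0 < e ->
  continuous (fun t : R => shrink_deriv e (u + t *: delta_mx 0 i) i).
Proof.
move=> e0 t; have D0 y := lt0r_neq0 (add_sqnorm_gt0 y e0).
pose f (y : R) := ((u + y *: delta_mx 0 i) *m Q) 0 i.
pose q (y : R) := sqnorm (u + y *: delta_mx 0 i).
have cf : {for t, continuous f}.
  apply/differentiable_continuous/derivable1_diffP.
  by case: (is_derive_proj u i i t).
have cq : {for t, continuous q}.
  apply/differentiable_continuous/derivable1_diffP.
  by case: (is_derive_sqnorm u i t).
have cD : (fun y => e + q y) @ t --> e + q t by apply: cvgD; [exact: cvg_cst|].
have sqr_cvg (g : R -> R) (l : R) : g @ t --> l ->
    (fun y => g y ^+ 2) @ t --> l ^+ 2.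
  by move=> gl; rewrite expr2; under eq_fun do rewrite expr2; exact: cvgM.
rewrite /shrink_deriv -/(f _) -/(q _).
apply: cvgB.
  by apply: cvgM; [exact: cvg_cst|apply: cvgV].
apply: cvgM; last by apply: cvgV; [rewrite expf_neq0|exact: sqr_cvg].
by apply: cvgM; [exact: cvg_cst|exact: sqr_cvg].
Qed.

Lemma sum_shrink_deriv e x : 0 < e ->
  \sum_i shrink_deriv e x i =
    \tr Q / (e + sqnorm x) - 2 * sqnorm x / (e + sqnorm x) ^+ 2.
Proof.
move=> e0; rewrite sumrB -!mulr_suml; congr (_ - _ / _).
by rewrite /sqnorm mulr_sumr.
Qed.

Lemma sum_sqr_shrink e x :
  \sum_i shrink e x i ^+ 2 = sqnorm x / (e + sqnorm x) ^+ 2.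
Proof. by rewrite mulr_suml; apply: eq_bigr => i _; rewrite expr_div_n. Qed.

(** The right-hand side is the pointwise risk reduction, up to the factor [s^4], once Stein's
    identity has replaced the cross term by the divergence. The lower bound is free of [e], so it
    survives the limit. *)
Lemma stein_gap e x : 0 < e <= 1 -> 2 < \tr Q ->
  (\tr Q - 2) ^+ 2 / (1 + sqnorm x) <=
  2 * (\tr Q - 2) * (\sum_i shrink_deriv e x i)
    - (\tr Q - 2) ^+ 2 * \sum_i shrink e x i ^+ 2.
Proof.
move=> /andP[e0 e1] r2; rewrite sum_shrink_deriv// sum_sqr_shrink.
have De := add_sqnorm_gt0 x e0; have q0 := sqnorm_ge0 x.
set q := sqnorm x in De q0 *; set c := \tr Q - 2.
have c0 : 0 < c by rewrite subr_gt0.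
have -> : \tr Q = c + 2 by rewrite subrK.
(* Obtained by writing [q = (e + q) - e] in the numerators. The remainder is nonnegative as [c > 0],
   and [e <= 1] turns [e + q] into [1 + q]. *)
rewrite (_ : _ - _ = c ^+ 2 / (e + q) + e * c * (c + 4) / (e + q) ^+ 2);
  last first.
  by field; rewrite gt_eqF.
apply: ler_wpDr.
  apply: divr_ge0; last exact: sqr_ge0.
  by rewrite !mulr_ge0// ?(ltW c0) ?(ltW e0)// addr_ge0// ltW.
rewrite ler_wpM2l ?sqr_ge0// lef_pV2 ?posrE ?lerD2r//.
by rewrite ltr_pwDl.
Qed.

End shrinkage.

(** * Measurability of the shrinkage field *)

Lemma measurable_inv_gt0 {R : realType} d (T : measurableType d) (f : T -> R) :
  (forall x, 0 < f x) -> measurable_fun setT f ->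
  measurable_fun setT (fun x => (f x)^-1).
Proof.
move=> f0 mf.
apply: (@measurable_comp _ _ _ _ _ _ [set r : R | r != 0] (@GRing.inv R)) => //.
- exact: open_measurable.
- by move=> _ [x _ <-]; rewrite /= gt_eqF.
- apply: open_continuous_measurable_fun => //; apply/in_setP => x /= x0.
  exact: inv_continuous.
Qed.

Section measurable_shrink.
Context {R : realType} {p : nat} (Q : 'M[R]_p) d (T : measurableType d)
  (v : T -> 'rV[R]_p).
Hypothesis mv : forall j, measurable_fun setT (fun w => v w 0 j).

Lemma measurable_proj j : measurable_fun setT (fun w => (v w *m Q) 0 j).
Proof.
under eq_fun do rewrite mxE.
by apply: measurable_sum => k; apply: measurable_funM.
Qed.

Lemma measurable_sqnorm : measurable_fun setT (fun w => sqnorm Q (v w)).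
Proof.
by apply: measurable_sum => j; apply: measurable_funX; exact: measurable_proj.
Qed.

Lemma measurable_inv_sqnorm e : 0 < e ->
  measurable_fun setT (fun w => (e + sqnorm Q (v w))^-1).
Proof.
move=> e0; apply: measurable_inv_gt0 => [x|]; first exact: add_sqnorm_gt0.
by apply: measurable_funD => //; exact: measurable_sqnorm.
Qed.

Lemma measurable_shrink e i : 0 < e ->
  measurable_fun setT (fun w => shrink Q e (v w) i).
Proof.
move=> e0; apply: measurable_funM; first exact: measurable_proj.
exact: measurable_inv_sqnorm.
Qed.

Lemma measurable_shrink_deriv e i : 0 < e ->
  measurable_fun setT (fun w => shrink_deriv Q e (v w) i).
Proof.
move=> e0; apply: measurable_funB.
  by apply: measurable_funM => //; exact: measurable_inv_sqnorm.
under eq_fun do rewrite -exprVn.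
apply: measurable_funM.
  apply: measurable_funM => //; apply: measurable_funX.
  exact: measurable_proj.
by apply: measurable_funX; exact: measurable_inv_sqnorm.
Qed.

End measurable_shrink.

(** * Risk of shrinkage under Gaussian noise *)

Section gaussian_shrinkage.
Context {R : realType} {d : measure_display} {Omega : measurableType d}
  (P : probability Omega R) {p : nat} (s : R) (Z : 'I_p -> {RV P >-> R})
  (theta : 'rV[R]_p) (Q : 'M[R]_p).
Hypotheses (s0 : 0 < s) (gaussZ : isotropic_gaussian s Z).
Hypotheses (Qsym : Q^T = Q) (Qidem : Q *m Q = Q).

Let X w := theta + noise_vector Z w.

Let mX j : measurable_fun setT (fun w => X w 0 j).
Proof.
rewrite /X /noise_vector; under eq_fun do rewrite !mxE.
apply: measurable_funD => //; exact: (measurable_funP (Z j)).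
Qed.

Lemma integrable_sqr_noise i : P.-integrable setT (fun w => (Z i w ^+ 2)%:E).
Proof.
have mZ : measurable_fun setT (fun w => Z i w ^+ 2).
  by apply: measurable_funX; exact: (measurable_funP (Z i)).
apply/integrableP; split; first exact/measurable_EFinP.
have msq : measurable_fun [set: measurableTypeR R]
    (fun x : R => `|(x ^+ 2)%:E|%E).
  apply: measurableT_comp => //; apply/measurable_EFinP.
  exact: measurable_funX.
have mZi : measurable_fun [set: Omega] (Z i : Omega -> measurableTypeR R).
  exact: (measurable_funP (Z i)).
have := @ge0_integral_pushforward _ _ _ _ _ _ mZi P setT _ measurableT msq
  (fun x _ => abse_ge0 _).
rewrite preimage_setT /= => <-.
rewrite (@eq_measure_integral _ _ _ _ (normal_prob 0 s)).
  by have /integrableP[] := normal_prob_integrable_sqr s0.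
by move=> A mA _; exact: gaussZ.2.
Qed.

Lemma integrable_sum_sqr_noise :
  P.-integrable setT (fun w => (\sum_j Z j w ^+ 2)%:E).
Proof.
under eq_fun do rewrite -sumEFin.
by apply: integrable_sum => // j _; exact: integrable_sqr_noise.
Qed.

Lemma stein_noise e i : 0 < e <= 1 ->
  P.-integrable setT
    (fun w => (Z i w * shrink Q e (X w) i
      - s ^+ 2 * shrink_deriv Q e (X w) i)%:E) /\
  (\int[P]_w (Z i w * shrink Q e (X w) i
    - s ^+ 2 * shrink_deriv Q e (X w) i)%:E = 0)%E.
Proof.
move=> e01; have /andP[e0 e1] := e01.
(* Since [others] has 0 in slot [i], [u] is the observation without its [i]-th noise coordinate, and
   [line] adds that coordinate back along the [i]-th axis. For fixed [y] this is the setting of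
   [stein_normal]. *)
pose u (y : p.-tuple (measurableTypeR R)) := theta + \row_j tnth y j.
pose line (z : measurableTypeR R * p.-tuple (measurableTypeR R)) :=
  u z.2 + z.1 *: delta_mx 0 i.
pose g z := z.1 * shrink Q e (line z) i - s ^+ 2 * shrink_deriv Q e (line z) i.
have lineX w : line (with_others Z i w) = X w.
  apply/rowP => j; rewrite /line /u /X !mxE /= tnth_mktuple.
  by case: eqP => [->|_]; rewrite ?mulr1 ?mulr0 ?addr0.
have mline j : measurable_fun setT (fun z => line z 0 j).
  rewrite /line /u; under eq_fun do rewrite !mxE.
  apply: measurable_funD; last by apply: measurable_funM.
  apply: measurable_funD => //.
  have := measurableT_comp (@measurable_tnth _ (measurableTypeR R) p j)
    measurable_snd.
  exact.
have mg : measurable_fun setT g.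
  apply: measurable_funB; apply: measurable_funM => //.
  - exact: measurable_shrink.
  - exact: measurable_shrink_deriv.
have gE w : g (with_others Z i w) =
    Z i w * shrink Q e (X w) i - s ^+ 2 * shrink_deriv Q e (X w) i.
  by rewrite /g lineX.
(* One constant bounding both the field and its derivative: it is the bound of
   [norm_shrink_deriv_le], and it exceeds the bound [e^-1] of [norm_shrink_le]. *)
pose K := (`|Q i i| + 2) / e.
have K0 : 0 <= K by rewrite /K divr_ge0// ?ltW// addr_ge0.
have eK : e^-1 <= K.
  rewrite /K ler_peMl ?invr_ge0 ?(ltW e0)//.
  by have := normr_ge0 (Q i i); lra.
have ig : P.-integrable setT (fun w => (g (with_others Z i w))%:E).
  have i1 : P.-integrable setT
      (fun w => (K * (1 + s ^+ 2))%:E + K%:E * (Z i w ^+ 2)%:E)%E.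
    apply: integrableD => //; first exact: finite_measure_integrable_cst.
    by apply: integrableZl => //; exact: integrable_sqr_noise.
  apply: le_integrable i1 => //.
    apply/measurable_EFinP.
    exact: (measurableT_comp mg (measurable_with_others Z i)).
  move=> w _; rewrite gE -EFinM -EFinD !abse_EFin lee_fin.
  apply: le_trans (ler_norm _); apply: le_trans (ler_normB _ _) _.
  rewrite normrM (normrM (s ^+ 2)) (ger0_norm (sqr_ge0 s)).
  have h1 := le_trans (norm_shrink_le Q (X w) i e01) eK.
  have h2 := norm_shrink_deriv_le Q (X w) i e0.
  have := ler_pM (normr_ge0 (Z i w)) (normr_ge0 _) (lexx _) h1.
  have := ler_wpM2l (sqr_ge0 s) h2.
  have x1 : `|Z i w| <= 1 + Z i w ^+ 2.
    by rewrite -(real_normK (num_real (Z i w))); nra.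
  have := ler_wpM2r K0 x1; rewrite -/K; lra.
split; first by under eq_fun do rewrite -gE.
under eq_integral do rewrite -gE.
apply: (integral_with_others0 gaussZ.1 (gaussZ.2 i)) => // y.
apply: (@stein_normal _ s (fun x : R => shrink Q e (u y + x *: delta_mx 0 i) i)
  (fun x => shrink_deriv Q e (u y + x *: delta_mx 0 i) i) K) => //.
- by move=> x; exact: is_derive_shrink.
- exact: continuous_shrink_deriv.
- by move=> x; exact: le_trans (norm_shrink_le _ _ _ e01) eK.
- by move=> x; exact: norm_shrink_deriv_le.
Qed.

(** Expanding the square leaves a cross term between noise and field. Up to the mean-zero sum [H] it
    equals [s^2] times the divergence of the field, after which [stein_gap] applies pointwise. *)
Lemma regularized_risk e : 0 < e <= 1 -> 2 < \tr Q ->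
  (\int[P]_w (\sum_j
      (Z j w - (\tr Q - 2) * s ^+ 2 * shrink Q e (X w) j) ^+ 2)%:E
   <= \int[P]_w (\sum_j Z j w ^+ 2)%:E
      - ((\tr Q - 2) ^+ 2 * s ^+ 4)%:E *
        \int[P]_w ((1 + sqnorm Q (X w))^-1)%:E)%E.
Proof.
move=> e01 r2; have /andP[e0 e1] := e01; set c := \tr Q - 2.
pose N w := \sum_j Z j w ^+ 2.
pose T w := (1 + sqnorm Q (X w))^-1.
pose G j w := Z j w * shrink Q e (X w) j - s ^+ 2 * shrink_deriv Q e (X w) j.
have iN : P.-integrable setT (EFin \o N) := integrable_sum_sqr_noise.
have mT : measurable_fun setT T by exact: measurable_inv_sqnorm.
have iT : P.-integrable setT (EFin \o T).
  apply: (le_integrable measurableT _ _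
    (finite_measure_integrable_cst P 1 measurableT)).
    exact/measurable_EFinP.
  move=> w _; rewrite /= lee_fin normr1 /T ger0_norm; last first.
    by rewrite invr_ge0 ltW// add_sqnorm_gt0.
  by rewrite invf_le1 ?add_sqnorm_gt0// lerDl sqnorm_ge0.
have iG j : P.-integrable setT (EFin \o G j).
  by have [] := stein_noise j e01.
pose H w := \sum_j G j w.
have iH : P.-integrable setT (EFin \o H).
  rewrite (_ : EFin \o H = fun w => \sum_j (G j w)%:E)%E; last first.
    by apply/funext => w; rewrite /= sumEFin.
  by apply: integrable_sum => // j _; exact: iG.
have H0 : (\int[P]_w (H w)%:E = 0)%E.
  under eq_integral do rewrite -sumEFin.
  rewrite integral_sum// big1// => j _.
  by have [] := stein_noise j e01.
pose k1 := 2 * c * s ^+ 2; pose k2 := c ^+ 2 * s ^+ 4.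
have le1 w : \sum_j (Z j w - c * s ^+ 2 * shrink Q e (X w) j) ^+ 2 <=
    N w - (k1 * H w + k2 * T w).
  have gap := ler_wpM2l (sqr_ge0 (s ^+ 2)) (stein_gap (X w) e01 r2).
  have -> : \sum_j (Z j w - c * s ^+ 2 * shrink Q e (X w) j) ^+ 2 =
      N w - (k1 * H w + (s ^+ 2) ^+ 2 *
        (2 * c * (\sum_i shrink_deriv Q e (X w) i)
        - c ^+ 2 * \sum_i shrink Q e (X w) i ^+ 2)).
    rewrite /N /H !mulr_sumr -sumrB !mulr_sumr -big_split -sumrB/=.
    by apply: eq_bigr => j _; rewrite /G /k1; ring.
  rewrite lerB// lerD2l; apply: le_trans gap.
  rewrite (_ : k2 * T w = (s ^+ 2) ^+ 2 * (c ^+ 2 * T w))//; rewrite /k2; ring.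
have ik1 := integrableZl measurableT k1 iH.
have ik2 := integrableZl measurableT k2 iT.
have -> : (\int[P]_w (N w)%:E - k2%:E * \int[P]_w (T w)%:E =
    \int[P]_w (N w - (k1 * H w + k2 * T w))%:E)%E.
  under [RHS]eq_integral do rewrite EFinB EFinD !EFinM.
  rewrite integralB//; last exact: integrableD.
  by rewrite integralD// !integralZl// H0 mule0 add0e.
apply: ge0_le_integral => //.
- by move=> w _; rewrite lee_fin sumr_ge0// => j _; exact: sqr_ge0.
- apply/measurable_EFinP/measurable_sum => j; apply: measurable_funX.
  apply: measurable_funB; first exact: (measurable_funP (Z j)).
  by apply: measurable_funM => //; exact: measurable_shrink.
- have := measurable_int _ (integrableB measurableT iN
    (integrableD measurableT ik1 ik2)).
  exact.
- by move=> w _; rewrite lee_fin.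
Qed.

Lemma inv_sqnorm_integral_gt0 :
  (0 < \int[P]_w ((1 + sqnorm Q (X w))^-1)%:E)%E.
Proof.
have T0 w : 0 < (1 + sqnorm Q (X w))^-1 by rewrite invr_gt0 add_sqnorm_gt0.
have mT : measurable_fun setT (fun w => ((1 + sqnorm Q (X w))^-1)%:E).
  by apply/measurable_EFinP; exact: measurable_inv_sqnorm.
rewrite lt0e integral_ge0 ?andbT; last by move=> w _; rewrite lee_fin ltW.
apply/eqP => I0.
have : ae_eq P setT (fun w => ((1 + sqnorm Q (X w))^-1)%:E) (cst 0%E).
  apply/ae_eq_integral_abs => //; rewrite -[RHS]I0.
  by apply: eq_integral => w _; rewrite gee0_abs// lee_fin ltW.
move=> [A [mA A0 sA]].
(* The integrand is positive everywhere, so a set containing every point where it is nonzero is the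
   whole space, which is not null. *)
have AT : A = setT.
  apply/seteqP; split => // w _; apply: sA => /= /(_ I)[] /eqP.
  by rewrite gt_eqF.
have P1 := probability_setT P; have : (1 = 0 :> \bar R)%E by rewrite -P1 -A0 AT.
by move/eqP; rewrite onee_eq0.
Qed.

Lemma shrinkage_dominates : 2 < \tr Q ->
  (\int[P]_w (\sum_j (Z j w - (\tr Q - 2) * s ^+ 2 *
      ((X w *m Q) 0 j / sqnorm Q (X w))) ^+ 2)%:E
   < \int[P]_w (\sum_j Z j w ^+ 2)%:E)%E.
Proof.
move=> r2; pose e n : R := n.+1%:R^-1.
have e01 n : 0 < e n <= 1 by rewrite invr_gt0 ltr0Sn invf_le1 ?ltr0Sn// ler1n.
set c := \tr Q - 2; have c0 : 0 < c by rewrite subr_gt0.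
pose F n w := (\sum_j (Z j w - c * s ^+ 2 * shrink Q (e n) (X w) j) ^+ 2)%:E.
set A := (\int[P]_w (\sum_j Z j w ^+ 2)%:E)%E.
set B := (\int[P]_w ((1 + sqnorm Q (X w))^-1)%:E)%E.
have Afin : A \is a fin_num.
  by apply: integrable_fin_num => //; exact: integrable_sum_sqr_noise.
have B0 : (0 < B)%E by exact: inv_sqnorm_integral_gt0.
have shrinkcvg w j : shrink Q (e n) (X w) j @[n --> \oo] -->
    (X w *m Q) 0 j / sqnorm Q (X w).
  (* Where [q] vanishes, so does [XQ]. The regularized field is then 0 for every [n], which matches
     the convention [0 / 0 = 0] in the limit, so convergence holds at every [w] and not only almost
     surely. *)
  have [q0|q0] := eqVneq (sqnorm Q (X w)) 0.
    have v0 : (X w *m Q) 0 j = 0.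
      apply/eqP; rewrite -sqrf_eq0 eq_le sqr_ge0 andbT -q0.
      exact: sqr_le_sqnorm.
    under eq_fun do rewrite /shrink v0 mul0r.
    by rewrite v0 mul0r; exact: cvg_cst.
  apply: cvgM; first exact: cvg_cst.
  apply: cvgV => //; rewrite -[X in _ --> X]add0r.
  apply: cvgD; [exact: cvg_harmonic|exact: cvg_cst].
have Fcvg w : F n w @[n --> \oo] --> (\sum_j (Z j w - c * s ^+ 2 *
      ((X w *m Q) 0 j / sqnorm Q (X w))) ^+ 2)%:E.
  apply: cvg_EFin; first exact: nearW.
  apply: cvg_big => [x|j _]; first exact: add_continuous.
  have h : (Z j w - c * s ^+ 2 * shrink Q (e n) (X w) j) @[n --> \oo] -->
      Z j w - c * s ^+ 2 * ((X w *m Q) 0 j / sqnorm Q (X w)).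
    apply: cvgB; first exact: cvg_cst.
    by apply: cvgM; [exact: cvg_cst|exact: shrinkcvg].
  by rewrite expr2; under eq_fun do rewrite /= expr2; exact: cvgM.
(* Strictness comes from here: [A] is finite, so subtracting a positive quantity makes it strictly
   smaller. *)
apply: (@le_lt_trans _ _ (A - (c ^+ 2 * s ^+ 4)%:E * B)%E); last first.
  rewrite -[ltRHS]adde0 lteD2lE// oppe_lt0.
  by rewrite mule_gt0// lte_fin mulr_gt0// exprn_gt0.
apply: (@le_trans _ _ (limn_einf (fun n => \int[P]_w F n w)%E)).
  apply: le_trans (fatou _ _ _ _) => //.
  - rewrite le_eqVlt; apply/orP; left; apply/eqP; apply: eq_integral => w _.
    by have [-> _] := cvg_limn_einf_sup (Fcvg w).
  - move=> n; have /andP[en _] := e01 n.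
    apply/measurable_EFinP/measurable_sum => j; apply: measurable_funX.
    apply: measurable_funB; first exact: (measurable_funP (Z j)).
    by apply: measurable_funM => //; exact: measurable_shrink.
  - by move=> n w _; rewrite lee_fin sumr_ge0// => j _; exact: sqr_ge0.
(* Each tail infimum is at most its first term, which [regularized_risk] bounds uniformly in [n]. *)
rewrite limn_einf_lim; apply: lime_le; first exact: is_cvg_einfs.
apply: nearW => n; apply: (@le_trans _ _ (\int[P]_w F n w)%E).
  by apply: ereal_inf_lbound; exists n => /=.
exact: regularized_risk.
Qed.

End gaussian_shrinkage.

(** * Risk comparison *)

Lemma sqr_l2norm {R : realType} {p : nat} (x : 'rV[R]_p) :
  l2norm x ^+ 2 = \sum_j x 0 j ^+ 2.
Proof. by rewrite sqr_sqrtr// sumr_ge0// => j _; exact: sqr_ge0. Qed.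

Section averaging.
Context {R : realType} {p : nat}.
Hypothesis p0 : (0 < p)%N.

Definition centering : 'M[R]_p := 1%:M - p%:R^-1 *: const_mx 1.

Let pn0 : p%:R != 0 :> R. Proof. by rewrite pnatr_eq0 -lt0n. Qed.

Lemma mul_centering (x : 'rV[R]_p) : x *m centering = centered x.
Proof.
rewrite /centering mulmxBr mulmx1 -scalemxAr; congr (_ - _).
apply/rowP => j; rewrite !mxE; congr (_ * _).
by apply: eq_bigr => k _; rewrite mxE mulr1.
Qed.

Lemma tr_centering : centering^T = centering.
Proof. by rewrite linearB linearZ/= trmx1 trmx_const. Qed.

(** The all-ones matrix [J] satisfies [J^2 = p J], so [J / p] is idempotent and hence so is its
    complement. *)
Lemma centering_idem : centering *m centering = centering.
Proof.
rewrite /centering mulmxBr mulmx1 mulmxBl mul1mx -scalemxAl -!scalemxAr.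
rewrite (_ : const_mx 1 *m const_mx 1 = p%:R *: const_mx 1 :> 'M[R]_p).
  by rewrite (scalerA _ p%:R) mulVf// scale1r subrr subr0.
apply/matrixP => i j; rewrite !mxE mulr1.
by under eq_bigr do rewrite !mxE mulr1; rewrite sumr_const card_ord.
Qed.

Lemma mxtrace_centering : \tr centering = p%:R - 1.
Proof.
rewrite linearB linearZ/= mxtrace1; congr (_ - _).
rewrite /mxtrace; under eq_bigr do rewrite mxE.
by rewrite sumr_const card_ord mulVf.
Qed.

End averaging.

Theorem theorem5 (R : realType) (X : Type) (n p : nat)
  (theta : n.-tuple X -> 'rV[R]_p) (mu Delta2 : R)
  (hmu : 0 < mu) (hDelta2 : 0 < Delta2)
  (hsens : l2_sensitivity theta = Delta2%:E)
  (d : measure_display) (Omega : measurableType d) (P : probability Omega R)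
  (Z : 'I_p -> {RV P >-> R})
  (hZ : isotropic_gaussian (Delta2 / mu) Z) :
  ((3 <= p)%N ->
     strictly_dominates P theta (js_zero_mech (Delta2 / mu) theta Z)
                                (gaussian_mech theta Z)) /\
  ((4 <= p)%N ->
     strictly_dominates P theta (js_avg_mech (Delta2 / mu) theta Z)
                                (gaussian_mech theta Z)).
Proof.
set s := Delta2 / mu in hZ *; have s0 : 0 < s by exact: divr_gt0.
have costG S : l2_cost P theta (gaussian_mech theta Z) S =
    (\int[P]_w (\sum_j Z j w ^+ 2)%:E)%E.
  rewrite /l2_cost unlock; apply: eq_integral => w _.
  rewrite sqr_l2norm /gaussian_mech addrAC subrr add0r.
  by congr (_%:E); apply: eq_bigr => j _; rewrite mxE.
split=> hp S; rewrite costG /l2_cost unlock.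
(* Shrinking to zero is the case [Q = 1], where the trace is [p] and the constant is [p - 2]. *)
- have r2 : 2 < \tr (1%:M : 'M[R]_p) by rewrite mxtrace1 (ltr_nat _ 2).
  have := shrinkage_dominates (theta S) s0 hZ (trmx1 _ _) (mul1mx 1%:M) r2.
  apply: le_lt_trans; rewrite mxtrace1.
  rewrite le_eqVlt; apply/orP; left; apply/eqP; apply: eq_integral => w _.
  rewrite sqr_l2norm; congr (_%:E); apply: eq_bigr => j _; congr (_ ^+ 2).
  rewrite /js_zero_mech /js_zero /gaussian_mech sqr_l2norm /sqnorm mulmx1.
  by rewrite !mxE; ring.
- have p0 : (0 < p)%N by apply: leq_trans hp.
  (* Centering loses the direction of constant vectors, so the trace is [p - 1]: it exceeds 2 from
     [p = 4] on, and the constant becomes [p - 3]. *)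
  have r2 : 2 < \tr (centering : 'M[R]_p).
    have : 4 <= p%:R :> R by rewrite (ler_nat _ 4).
    by rewrite mxtrace_centering//; lra.
  have := shrinkage_dominates (theta S) s0 hZ tr_centering
    (centering_idem p0) r2.
  apply: le_lt_trans; rewrite mxtrace_centering//.
  rewrite (_ : p%:R - 1 - 2 = p%:R - 3); last by ring.
  rewrite le_eqVlt; apply/orP; left; apply/eqP; apply: eq_integral => w _.
  rewrite sqr_l2norm; congr (_%:E); apply: eq_bigr => j _; congr (_ ^+ 2).
  rewrite /js_avg_mech /js_avg /gaussian_mech sqr_l2norm /sqnorm.
  rewrite mul_centering//.
  by rewrite !mxE; ring.
Qed.
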